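(* Let $L=J(P)$ be a finite distributive lattice, of rank $m=|P|$, and let $\eta=(\eta(0),\eta(1),\ldots,\eta(m))$ be a cell of $\mathrm{Hom}(L)=\mathrm{Hom}(C_m,L)$. Then $|\eta(j)|\in\{1,2\}$ for all $j$. Furthermore, if $|\eta(j)|=2$, then $|\eta(j-1)|=1$ when $j\ge 1$ and $|\eta(j+1)|=1$ when $j\le m-1$. Hence $\mathrm{Hom}(L)$ is a cubical complex.
   Context: For a finite poset $P$, $J(P)$ is the lattice of lower order ideals of $P$ ordered by inclusion. $C_m$ denotes the chain $0<1<\cdots<m$. For finite posets $A,B$, $\mathrm{Hom}(A,B)$ is the subcomplex of the product of simplices $\prod_{a\in A}\Delta_B$ whose cells are tuples $(X_a)_{a\in A}$ of nonempty subsets of $B$ such that every map $\eta:A\to B$ with $\eta(a)\in X_a$ for all $a$ is strictly order-preserving; the cell $(X_a)$ is the product of simplices $\Delta_{X_a}$. For a graded poset $L$ of rank $m$, $\mathrm{Hom}(L):=\mathrm{Hom}(C_m,L)$; its vertices are the maximal chains of $L$. A cell of $\mathrm{Hom}(C_m,L)$ is written $\eta=(\eta(0),\ldots,\eta(m))$ with $\eta(j)\subseteq L$. *)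

(* Defs.v *)
From HB Require Import structures.
From mathcomp Require Import all_boot all_order all_algebra.
Set Implicit Arguments.
Unset Strict Implicit.
Unset Printing Implicit Defensive.
Import Order.TTheory GRing.Theory Num.Theory.

Fact ideal_display : Order.disp_t. Proof. exact: (Order.Disp tt tt). Qed.

Section OrderIdeals.
Variables (d : Order.disp_t) (P : finPOrderType d).

Definition is_ideal (I : {set P}) : bool :=
  [forall x in I, forall y, (y <= x)%O ==> (y \in I)].

(* The type [ideal P] is J(P). *)
Record ideal := Ideal { ideal_set :> {set P}; _ : is_ideal ideal_set }.

HB.instance Definition _ := [isSub for ideal_set].
HB.instance Definition _ := [Finite of ideal by <:].

Lemma idealP (I : {set P}) :
  reflect (forall x y, (y <= x)%O -> x \in I -> y \in I) (is_ideal I).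
Proof.
apply: (iffP forall_inP) => [h x y yx xI|h x xI].
  by have /forallP/(_ y) := h x xI; rewrite yx.
by apply/forallP => y; apply/implyP => /h; apply.
Qed.

Fact set0_ideal : is_ideal set0.
Proof. by apply/idealP => x y _; rewrite inE. Qed.

Fact setT_ideal : is_ideal setT.
Proof. by apply/idealP => x y _; rewrite !inE. Qed.

Fact setI_ideal (I J : ideal) : is_ideal (I :&: J).
Proof.
have /idealP hI := valP I; have /idealP hJ := valP J.
apply/idealP => x y yx; rewrite !inE => /andP[xI xJ].
by rewrite (hI _ _ yx xI) (hJ _ _ yx xJ).
Qed.

Fact setU_ideal (I J : ideal) : is_ideal (I :|: J).
Proof.
have /idealP hI := valP I; have /idealP hJ := valP J.
apply/idealP => x y yx; rewrite !inE => /orP[xI|xJ].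
  by rewrite (hI _ _ yx xI).
by rewrite (hJ _ _ yx xJ) orbT.
Qed.

Definition ideal_le (I J : ideal) : bool := I \subset J.
Definition ideal_lt (I J : ideal) : bool := (J != I) && (I \subset J).
Definition ideal_meet (I J : ideal) : ideal := Ideal (setI_ideal I J).
Definition ideal_join (I J : ideal) : ideal := Ideal (setU_ideal I J).

Fact ideal_le_def I J : ideal_le I J = (ideal_meet I J == I).
Proof. by rewrite /ideal_le -val_eqE /= (sameP setIidPl eqP). Qed.
Fact ideal_meetC : commutative ideal_meet.
Proof. by move=> I J; apply: val_inj; rewrite /= setIC. Qed.
Fact ideal_joinC : commutative ideal_join.
Proof. by move=> I J; apply: val_inj; rewrite /= setUC. Qed.
Fact ideal_meetA : associative ideal_meet.
Proof. by move=> I J K; apply: val_inj; rewrite /= setIA. Qed.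
Fact ideal_joinA : associative ideal_join.
Proof. by move=> I J K; apply: val_inj; rewrite /= setUA. Qed.
Fact ideal_joinKI J I : ideal_meet I (ideal_join I J) = I.
Proof. by apply: val_inj; rewrite /= setUC setKU. Qed.
Fact ideal_meetKU J I : ideal_join I (ideal_meet I J) = I.
Proof. by apply: val_inj; rewrite /= setIC setKI. Qed.
Fact ideal_meetUl : left_distributive ideal_meet ideal_join.
Proof. by move=> I J K; apply: val_inj; rewrite /= setIUl. Qed.
Fact ideal_meetxx : idempotent_op ideal_meet.
Proof. by move=> I; apply: val_inj; rewrite /= setIid. Qed.

HB.instance Definition _ :=
  Order.isMeetJoinDistrLattice.Build ideal_display ideal
    ideal_le_def (fun I J : ideal => erefl (ideal_lt I J))
    ideal_meetC ideal_joinC ideal_meetA ideal_joinA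
    ideal_joinKI ideal_meetKU ideal_meetUl ideal_meetxx.

Fact ideal_le0x (I : ideal) : (Ideal set0_ideal <= I)%O.
Proof. exact: sub0set. Qed.
Fact ideal_lex1 (I : ideal) : (I <= Ideal setT_ideal)%O.
Proof. exact: subsetT. Qed.

HB.instance Definition _ := Order.hasBottom.Build ideal_display ideal ideal_le0x.
HB.instance Definition _ := Order.hasTop.Build ideal_display ideal ideal_lex1.
End OrderIdeals.

From mathcomp Require Import boolp classical_sets cardinality reals.

Local Open Scope classical_set_scope.
Local Open Scope ring_scope.

Section PolytopalComplexes.
Variables (R : realType) (V : lmodType R).
Implicit Types (Q F : set V) (K : set (set V)).

Definition polytope Q : Prop :=
  exists (n : nat) (v : 'I_n -> V),
    Q = [set x | exists w : 'I_n -> R,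
           [/\ forall i, 0 <= w i, \sum_i w i = 1 & x = \sum_i w i *: v i]].

(* Faces are the sets cut out by valid linear inequalities; the empty set and
   Q itself are included. *)
Definition face Q F : Prop :=
  exists (l : {scalar V}) (c : R),
    (forall x, Q x -> l x <= c) /\ F = [set x | Q x /\ l x = c].

(* Q is affinely isomorphic to [0,1]^n for some n. *)
Definition cube Q : Prop :=
  exists (n : nat) (f : {linear 'rV[R]_n -> V}) (t : V),
    injective f /\
    Q = (fun x => t + f x) @` [set x : 'rV[R]_n | forall i, 0 <= x ord0 i <= 1].

(* The cells are the nonempty ones, so that a common face may be empty without
   belonging to K. *)
Definition polytopal_complex K : Prop :=
  [/\ finite_set K,
      forall Q, K Q -> polytope Q /\ Q !=set0,
      forall Q F, K Q -> face Q F -> F !=set0 -> K F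
    & forall Q Q', K Q -> K Q' -> face Q (Q `&` Q') /\ face Q' (Q `&` Q')].

Definition cubical_complex K : Prop :=
  polytopal_complex K /\ forall Q, K Q -> cube Q.
End PolytopalComplexes.

Section HomComplex.
Variables (dA dB : Order.disp_t) (A : finPOrderType dA) (B : finPOrderType dB).

Definition hom_cell (X : {ffun A -> {set B}}) : Prop :=
  (forall a, X a != finset.set0) /\
  forall f : A -> B, (forall a, f a \in X a) -> {homo f : x y / (x < y)%O}.

Variable R : realType.

(* The face of the standard simplex of R^B spanned by the vertices in X. *)
Definition simplex (X : {set B}) : set {ffun B -> R^o} :=
  [set x | [/\ forall b, 0 <= x b, \sum_b x b = 1
             & forall b, b \notin X -> x b = 0]].

Definition cell_polytope (X : {ffun A -> {set B}}) :
    set {ffun A -> {ffun B -> R^o}} :=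
  [set x | forall a, simplex (X a) (x a)].

Definition hom_complex : set (set {ffun A -> {ffun B -> R^o}}) :=
  cell_polytope @` hom_cell.
End HomComplex.

Arguments hom_complex {dA dB} A B R.

(* Main.v *)
(** Since the elements chosen from eta(0), ..., eta(m) always form a strict
    chain of m + 1 ideals of a set with m elements, every ideal in eta(j) has
    exactly j elements. If I and J are distinct members of eta(j), counting
    forces eta(j - 1) = {I /\ J} and eta(j + 1) = {I \/ J}, and distributivity
    excludes a third member. A product of simplices of dimension at most one is
    a cube; that the cells form a polytopal complex holds for every Hom(A, B),
    because faces of a product of simplices are products of faces. *)

Require Import Defs.
From HB Require Import structures.
From mathcomp Require Import all_boot all_order all_algebra.
From mathcomp Require Import boolp classical_sets cardinality reals.

Import Order.TTheory GRing.Theory Num.Theory.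

(** * Cells as convex hulls of their vertices *)

Section ProductOfSimplices.
Local Open Scope ring_scope.
Local Open Scope classical_set_scope.

(** Allows the spanning points to be indexed by a subset of any finite type, such as the choice
    functions of a cell. *)
Lemma polytope_convex_hull (R : realType) (W : lmodType R) (I : finType)
    (D : {pred I}) (v : I -> W) :
  polytope [set x | exists w : I -> R,
    [/\ forall i, i \in D -> 0 <= w i, \sum_(i in D) w i = 1
      & x = \sum_(i in D) w i *: v i]].
Proof.
exists #|D|, (v \o enum_val); apply/seteqP; split=> x /= [w [w0 w1 ->]].
  exists (w \o enum_val); split=> [i||] /=.
  - exact/w0/(enum_valP i).
  - by rewrite -w1 [RHS](big_enum_val (A := D)).
  - by rewrite (big_enum_val (A := D)).
(* [enum_rank_in] needs an element of [D]; were [D] empty, the weights would sum to 0 instead of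
   1. *)
have [i0 Di0|n0] := pickP D; last first.
  exfalso; have D0 : #|D| = 0%N by apply: eq_card0.
  move: w1; rewrite big1 => [/esym/eqP|i _]; first by rewrite oner_eq0.
  by have := ltn_ord i; rewrite [X in (_ < X)%N]D0.
have inD : i0 \in D by [].
exists (w \o enum_rank_in inD); split=> [i _||] //=.
- rewrite (big_enum_val (A := D)) -w1; apply: eq_bigr => i _.
  by rewrite /= enum_valK_in.
- rewrite [RHS](big_enum_val (A := D)); apply: eq_bigr => i _.
  by rewrite /= enum_valK_in.
Qed.

Context (dA dB : Order.disp_t) (A : finPOrderType dA) (B : finPOrderType dB).
Context (R : realType).
Implicit Types (X Y : {ffun A -> {set B}}) (g : A -> B).

Notation V := {ffun A -> {ffun B -> R^o}}.
Notation cellp := (@cell_polytope dA dB A B R).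

Definition vertex g : V := [ffun a => [ffun b => (b == g a)%:R]].

Lemma cell_polytope_vertex X g : (forall a, g a \in X a) -> cellp X (vertex g).
Proof.
move=> gX a; rewrite ffunE; split=> [b||b bX]; rewrite ?ffunE.
- exact: ler0n.
- under eq_bigr do rewrite ffunE.
  by rewrite (bigD1 (g a)) //= eqxx big1 ?addr0 // => b /negPf ->.
- by case: eqP bX => // ->; rewrite gX.
Qed.

Lemma sum_simplex X x a : cellp X x -> \sum_(b in X a) x a b = 1.
Proof.
move=> /(_ a)[_ <- x0]; rewrite [RHS](bigID (mem (X a))) /=.
by rewrite [X in _ = _ + X]big1 ?addr0.
Qed.

(* The weight of the vertex [g] is the product of the coordinates of [x]
   selected by [g]. *)
Lemma polytope_cell X : polytope (cellp X).
Proof.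
have coordE (D : {pred {ffun A -> B}}) (w : {ffun A -> B} -> R) a b :
    (\sum_(f in D) w f *: vertex f) a b = \sum_(f in D) w f * (b == f a)%:R.
  rewrite !sum_ffunE; apply: eq_bigr => g _.
  by rewrite !ffunE.
set S := cellp X.
suff -> : S = [set x | exists w : {ffun A -> B} -> R,
    [/\ forall f, f \in family (fun a => mem (X a)) -> 0 <= w f,
        \sum_(f in family (fun a => mem (X a))) w f = 1
      & x = \sum_(f in family (fun a => mem (X a))) w f *: vertex f]].
  exact: polytope_convex_hull.
apply/seteqP; split=> x /=; last first.
  case=> w [w0 w1 ->] a; split=> [b||b bX].
  - rewrite coordE; apply: sumr_ge0 => g gX.
    by rewrite mulr_ge0 ?w0 ?ler0n.
  - rewrite (eq_bigr _ (fun b _ => coordE _ _ a b)).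
    rewrite exchange_big /= -[RHS]w1; apply: eq_bigr => g _.
    rewrite -mulr_sumr (bigD1 (g a)) //= eqxx big1 ?addr0 ?mulr1 //.
    by move=> b /negPf ->.
  - rewrite coordE big1 // => g /familyP/(_ a) ga.
    by case: eqP bX => [->|_ _]; rewrite ?mulr0 // [_ \in _]ga.
move=> Sx; exists (fun f => \prod_a x a (f a)); split=> [f _||].
- by apply: prodr_ge0 => a _; case: (Sx a).
- rewrite -(bigA_distr_big_dep (fun a => mem (X a)) (fun a b => x a b)).
  by rewrite big1 // => a _; apply: sum_simplex.
apply/ffunP => a; apply/ffunP => b; rewrite coordE.
(* Inserting the indicator of [b] into factor [a] keeps the sum over [f] a product of sums: the
   other factors give 1 and factor [a] gives [x a b]. *)
pose F a' b' : R := x a' b' * (if a' == a then (b == b')%:R else 1).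
transitivity (\sum_(f in family (fun a => mem (X a))) \prod_a' F a' (f a')).
  rewrite -(bigA_distr_big_dep (fun a => mem (X a)) F) (bigD1 a) //=.
  rewrite [X in _ * X]big1 ?mulr1 => [|a' /negPf a'a]; last first.
    rewrite -[RHS](sum_simplex X x a' Sx); apply: eq_bigr => b' _.
    by rewrite /F a'a mulr1.
  rewrite /F eqxx; have [bX|bX] := boolP (b \in X a).
    rewrite (bigD1 b) //= eqxx mulr1 big1 ?addr0 // => b' /andP[_ b'b].
    by rewrite eq_sym (negPf b'b) mulr0.
  rewrite big1 => [|b' b'X]; first by case: (Sx a) => _ _ ->.
  by case: eqP bX => [->|_ _]; rewrite ?mulr0 // b'X.
apply: eq_bigr => g _; rewrite big_split /=; congr (_ * _).
by rewrite -big_mkcond big_pred1_eq.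
Qed.

(** * Linear functionals and faces of products of simplices *)

Section LinearForms.
Variable w : A -> B -> R.

Definition coord_form (x : V) : R := \sum_a \sum_b w a b * x a b.

Fact coord_form_is_scalar : scalar coord_form.
Proof.
move=> k x y; rewrite /coord_form mulr_sumr -big_split; apply: eq_bigr => a _.
rewrite mulr_sumr -big_split; apply: eq_bigr => b _.
by rewrite !ffunE mulrDr mulrCA.
Qed.

HB.instance Definition _ :=
  GRing.isLinear.Build R V R *%R coord_form coord_form_is_scalar.

End LinearForms.

Definition unit_point a b : V :=
  [ffun a' => [ffun b' => ((a' == a) && (b' == b))%:R]].

(** Expanding [x] in the basis of unit points gives an abstract functional coefficients that can be
    maximised factor by factor. *)
Lemma scalarE (l : {scalar V}) :
  l =1 coord_form (fun a b => l (unit_point a b)).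
Proof.
move=> x; rewrite {1}(_ : x = \sum_a \sum_b x a b *: unit_point a b).
  rewrite linear_sum; apply: eq_bigr => a _; rewrite linear_sum.
  by apply: eq_bigr => b _; rewrite linearZ mulrC.
apply/ffunP => a; apply/ffunP => b; rewrite !sum_ffunE.
rewrite (bigD1 a) //= [X in _ = _ + X]big1 ?addr0 => [|a' /negPf a'a].
  rewrite !sum_ffunE (bigD1 b) //= big1 ?addr0 => [|b' /negPf b'b].
    by rewrite !ffunE !eqxx [RHS]mulr1.
  by rewrite !ffunE (eq_sym b) b'b andbF [LHS]mulr0.
rewrite !sum_ffunE big1 // => b' _.
by rewrite !ffunE (eq_sym a) a'a [LHS]mulr0.
Qed.

Lemma hom_cell_sub X Y :
    (forall a, Y a \subset X a) -> (forall a, Y a != finset.set0) ->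
  hom_cell X -> hom_cell Y.
Proof.
move=> YX Y0 [_ hX]; split=> // f fY; apply: hX => a.
exact: (fintype.subsetP (YX a)).
Qed.

Lemma cell_polytope_subE X Y x : (forall a, Y a \subset X a) ->
  cellp Y x <-> cellp X x /\ forall a b, b \in X a -> b \notin Y a -> x a b = 0.
Proof.
move=> YX; split=> [Yx|[Xx x0] a].
  split=> [a|a b _ bY]; have [x0 x1 xY] := Yx a; last exact: xY.
  by split=> // b bX; apply: xY; apply: contra bX; apply/fintype.subsetP.
have [? ? xX] := Xx a; split=> // b bY.
by have [bX|/xX] := boolP (b \in X a); [apply: x0|].
Qed.

(* A linear form is maximised on a product of simplices by maximising it over
   each factor, so the face is spanned by the coordinatewise maximisers. *)
Lemma face_cell_polytope X F : (forall a, X a != finset.set0) ->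
    face (cellp X) F -> F !=set0 ->
  exists Y, [/\ forall a, Y a \subset X a, forall a, Y a != finset.set0
              & F = cellp Y].
Proof.
move=> X0 [l [c [lc ->]]] [x0 [Xx0 lx0]].
pose w a b := l (unit_point a b).
have /choice[g gP] : forall a, exists b, b \in X a /\
    forall b', b' \in X a -> w a b' <= w a b.
  move=> a; have /set0Pn[b0 b0X] := X0 a.
  case: (arg_maxP (P := mem (X a)) (w a) b0X) => b bX hb.
  by exists b.
have gX a : g a \in X a by have [] := gP a.
have gmax a b : b \in X a -> w a b <= w a (g a) by move=> ?; apply: (gP a).2.
pose Y := [ffun a => [set b in X a | w a b == w a (g a)]]%SET.
have YX a : Y a \subset X a by apply/fintype.subsetP => b; rewrite ffunE inE => /andP[].
have YE a b : b \in X a -> b \notin Y a -> w a (g a) - w a b != 0.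
  by move=> bX; rewrite ffunE inE bX /= subr_eq0 eq_sym.
(* Since each [x a] has total weight 1, the defect of [l x] from its maximum splits into terms that
   [gap_ge0] shows to be nonnegative. *)
have gapE x : cellp X x -> \sum_a w a (g a) - l x =
    \sum_a \sum_(b in X a) (w a (g a) - w a b) * x a b.
  move=> Xx; rewrite scalarE -sumrB; apply: eq_bigr => a _.
  rewrite (bigID (mem (X a))) /= [X in _ - (_ + X)]big1 => [|b bX]; last first.
    by have [_ _ ->] := Xx a; rewrite ?mulr0.
  rewrite addr0 -{1}[w a (g a)]mulr1 -(sum_simplex X x a Xx) mulr_sumr -sumrB.
  by apply: eq_bigr => b _; rewrite mulrBl.
have gap_ge0 x a b : cellp X x -> b \in X a ->
    0 <= (w a (g a) - w a b) * x a b.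
  by move=> Xx bX; have [? _ _] := Xx a; rewrite mulr_ge0 // subr_ge0 gmax.
have lvertex : l (vertex g) = \sum_a w a (g a).
  rewrite scalarE; apply: eq_bigr => a _; rewrite (bigD1 (g a)) //=.
  rewrite !ffunE eqxx mulr1 big1 ?addr0 // => b /negPf bg.
  by rewrite !ffunE bg mulr0.
(* Validity at [vertex g] bounds [c] from below; [x0], a point of the nonempty face, attains [c] and
   bounds it from above. *)
have cE : c = \sum_a w a (g a).
  apply/eqP; rewrite eq_le -{2}lvertex lc ?andbT; last first.
    exact: cell_polytope_vertex.
  rewrite -lx0 -subr_ge0 gapE //; apply: sumr_ge0 => a _.
  by apply: sumr_ge0 => b; apply: gap_ge0.
exists Y; split=> // [a|].
  by apply/set0Pn; exists (g a); rewrite ffunE inE gX eqxx.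
apply/seteqP; split=> x /=.
  case=> Xx lx; apply/(cell_polytope_subE X Y x YX); split=> // a b bX bY.
  (* A zero defect kills every term, and off [Y] the coefficient is nonzero, so the coordinate
     vanishes. *)
  have /eqP := gapE x Xx; rewrite lx cE subrr eq_sym psumr_eq0 => [|a' _].
    move=> /allP/(_ a (mem_index_enum _)) /=; rewrite psumr_eq0 => [|b' b'X].
      move=> /allP/(_ b (mem_index_enum _)) /=; rewrite bX /= mulf_eq0.
      by rewrite (negPf (YE a b bX bY)) /= => /eqP.
    exact: gap_ge0.
  by apply: sumr_ge0 => b'; apply: gap_ge0.
move/(cell_polytope_subE X Y x YX) => [Xx x0Y]; split=> //.
apply/esym/eqP; rewrite -subr_eq0 cE gapE // big1 // => a _.
rewrite big1 // => b bX; have [|bY] := boolP (b \in Y a).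
  by rewrite ffunE inE => /andP[_ /eqP ->]; rewrite subrr mul0r.
by rewrite x0Y ?mulr0.
Qed.

(** The supporting functional is minus the mass that [x] places outside [Y]: on the first cell it is
    at most 0, with equality exactly at the points of the second. *)
Lemma face_cell_polytopeI X Y : face (cellp X) (cellp X `&` cellp Y).
Proof.
pose w a b : R := - (b \notin Y a)%:R.
have wx_le0 x a b : cellp X x -> w a b * x a b <= 0.
  by move=> /(_ a)[x0 _ _]; rewrite mulNr oppr_le0 mulr_ge0 ?ler0n.
exists (coord_form w : {scalar V}), 0; split=> [x Xx|].
  by apply: sumr_le0 => a _; apply: sumr_le0 => b _; apply: wx_le0.
apply/seteqP; split=> x /= [Xx].
  move=> Yx; split=> //; rewrite /coord_form big1 // => a _; rewrite big1 // => b _.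
  have [_ _ xY] := Yx a; rewrite /w; case: (boolP (b \in Y a)) => [|/xY ->].
    by rewrite oppr0 mul0r.
  by rewrite mulr0.
move=> /eqP; rewrite -oppr_eq0 -sumrN psumr_eq0 => [/allP wx0|a _]; last first.
  by rewrite oppr_ge0; apply: sumr_le0 => b _; apply: wx_le0.
split=> // a; have [x0 x1 _] := Xx a; split=> // b bY.
have := wx0 a (mem_index_enum _); rewrite /= -sumrN psumr_eq0 => [/allP|b' _].
  move=> /(_ b (mem_index_enum _)) /=.
  by rewrite /w bY mulN1r opprK => /eqP.
by rewrite oppr_ge0; apply: wx_le0.
Qed.

Lemma hom_complex_polytopal : polytopal_complex (hom_complex A B R).
Proof.
split.
- exact/finite_image/finite_finset.
- move=> _ [X [X0 _] <-]; split; first exact: polytope_cell.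
  have /choice[g gX] : forall a, exists b, b \in X a by move=> a; apply/set0Pn.
  by exists (vertex g); apply: cell_polytope_vertex.
- move=> _ F [X hX <-] XF F0.
  have [Y [YX Y0 ->]] := face_cell_polytope X F hX.1 XF F0.
  by exists Y => //; apply: hom_cell_sub hX.
- move=> _ _ [X _ <-] [Y _ <-]; split; first exact: face_cell_polytopeI.
  by rewrite setIC; apply: face_cell_polytopeI.
Qed.

(** * Products of points and segments as cubes *)

Section CubeMap.
Variables p q : A -> B.

(** The factors that are genuine segments; their number is the dimension of the cube. *)
Definition split_set : {set A} := [set a | p a != q a]%SET.

(** By injectivity of [enum_val] the sum has at most one term; it is empty, hence 0, when [a] is
    outside [split_set]. *)
Definition cube_coord (x : 'rV[R]_#|split_set|) a : R :=
  \sum_(k | enum_val k == a) x ord0 k.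

(** Only the linear part, moving weight from [p a] to [q a]; the base point [vertex p] enters later
    as the translation. *)
Definition cube_map (x : 'rV[R]_#|split_set|) : V :=
  [ffun a => [ffun b => cube_coord x a * ((b == q a)%:R - (b == p a)%:R)]].

Fact cube_map_is_linear : linear cube_map.
Proof.
move=> c x y; apply/ffunP => a; apply/ffunP => b; rewrite !ffunE.
rewrite [X in _ = X + _]mulrA -mulrDl; congr (_ * _).
rewrite /cube_coord mulr_sumr -big_split; apply: eq_bigr => k _.
by rewrite !mxE.
Qed.

HB.instance Definition _ :=
  GRing.isLinear.Build R 'rV[R]_#|split_set| V *:%R cube_map cube_map_is_linear.

Lemma cube_coord_enum_val x k : cube_coord x (enum_val k) = x ord0 k.
Proof.
rewrite /cube_coord (bigD1 k) //= big1 ?addr0 // => k' /andP[/eqP/enum_val_inj].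
by move=> ->; rewrite eqxx.
Qed.

Lemma enum_val_split k : p (@enum_val _ (mem split_set) k) != q (enum_val k).
Proof. by have := enum_valP k; rewrite inE. Qed.

Lemma cube_map_inj : injective cube_map.
Proof.
move=> x y xy; apply/rowP => k.
have /ffunP/(_ (enum_val k))/ffunP/(_ (q (enum_val k))) := xy.
rewrite !ffunE !cube_coord_enum_val eqxx eq_sym (negPf (enum_val_split k)).
by rewrite subr0 !mulr1.
Qed.

End CubeMap.

(** A point of a segment is determined by its weight at one endpoint, so the weights at [q a] over
    the split factors serve as cube coordinates. *)
Lemma cube_cell_polytope X :
  (forall a, #|X a| = 1%N \/ #|X a| = 2%N) -> cube (cellp X).
Proof.
move=> X12.
(* A singleton gets two equal endpoints, which puts [a] outside [split_set]. *)
have /choice[pq pqP] : forall a, exists bb : B * B, X a = [set bb.1; bb.2]%SET.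
  move=> a; have [/eqP/cards1P[b ->]|/eqP/cards2P[b [b' [_ ->]]]] := X12 a.
    by exists (b, b); rewrite finset.setUid.
  by exists (b, b').
pose p a := (pq a).1; pose q a := (pq a).2.
have pX a : p a \in X a by rewrite pqP !inE eqxx.
have qX a : q a \in X a by rewrite pqP !inE eqxx orbT.
have XE a b : b \in X a = (b == p a) || (b == q a) by rewrite pqP !inE.
exists #|split_set p q|, (cube_map p q : {linear _ -> _}), (vertex p).
split; first exact: cube_map_inj.
have cubeE x a b : (vertex p + cube_map p q x) a b =
    (1 - cube_coord p q x a) * (b == p a)%:R
    + cube_coord p q x a * (b == q a)%:R.
  by rewrite !ffunE mulrBr mulrBl mul1r addrA addrAC.
apply/seteqP; split=> x /=; last first.
  case=> y y01 <- a.
  have /andP[c0 c1] : 0 <= cube_coord p q y a <= 1.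
    have [aS|aS] := boolP (a \in split_set p q).
      by rewrite -(enum_rankK_in aS aS) cube_coord_enum_val.
    rewrite /cube_coord big1 ?lexx ?ler01 // => k /eqP ka.
    by rewrite -ka enum_valP in aS.
  split=> [b||b]; rewrite ?cubeE.
  - by rewrite addr_ge0 // mulr_ge0 ?ler0n ?subr_ge0.
  - under eq_bigr do rewrite cubeE.
    have sum1 (b : B) : \sum_i (i == b)%:R = 1 :> R.
      by rewrite (bigD1 b) //= eqxx big1 ?addr0 // => i /negPf ->.
    by rewrite big_split /= -!mulr_sumr !sum1 !mulr1 subrK.
  - by rewrite XE negb_or => /andP[/negPf -> /negPf ->]; rewrite !mulr0 addr0.
move=> Xx; exists (\row_k x (enum_val k) (q (enum_val k))).
  move=> k; rewrite mxE; have [x0 x1 _] := Xx (enum_val k); rewrite x0 /=.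
  by rewrite -x1 (bigD1 (q (enum_val k))) //= lerDl sumr_ge0.
apply/ffunP => a; apply/ffunP => b; rewrite cubeE.
have [x0 x1 xX] := Xx a.
have := sum_simplex X x a Xx.
have [aS|] := boolP (a \in split_set p q).
  have := aS; rewrite inE => pq_neq.
  rewrite -(enum_rankK_in aS aS) cube_coord_enum_val mxE (enum_rankK_in aS aS).
  rewrite pqP big_setU1 ?inE //= big_set1 => /esym/eqP.
  rewrite -subr_eq => /eqP ->.
  have [->|bp] := eqVneq b (p a).
    by rewrite (negPf pq_neq) mulr1 mulr0 addr0.
  have [->|bq] := eqVneq b (q a); first by rewrite mulr1 mulr0 add0r.
  by rewrite !mulr0 addr0 xX // XE negb_or bp.
(* In a one-point factor both terms carry the same indicator, and their weights add up to 1. *)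
rewrite inE negbK => /eqP pqa; rewrite pqP -/(p a) -/(q a) -pqa.
rewrite finset.setUid big_set1.
rewrite -mulrDl subrK mul1r => xp.
have [->|bp] := eqVneq b (p a); first by rewrite xp.
by rewrite xX // XE -pqa orbb.
Qed.

End ProductOfSimplices.

(** * Cells of maximal chains in a lattice of ideals *)

Section MaximalChains.
Import mathcomp.boot.fintype mathcomp.boot.finset.
Context (d : Order.disp_t) (P : finPOrderType d) (m : nat).
Hypothesis hm : m = #|P|.
Variable eta : {ffun 'I_m.+1 -> {set ideal P}}.
Hypothesis eta_cell : hom_cell eta.
Implicit Types (i j : 'I_m.+1) (I J K L : ideal P).

Lemma hom_cell_neq0 j : exists I, I \in eta j.
Proof. exact/set0Pn/eta_cell.1. Qed.

(** The cell condition speaks of full choice functions, so [I] and [J] are completed by arbitrary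
    members at the other indices. *)
Lemma hom_cell_proper i j I J :
  i < j -> I \in eta i -> J \in eta j -> (I : {set P}) \proper J.
Proof.
move=> ij Ii Jj; have /choice[g gE] := hom_cell_neq0.
pose f k := if k == i then I else if k == j then J else g k.
have fE k : f k \in eta k by rewrite /f; do 2?case: eqP => [->|_].
have := eta_cell.2 f fE i j ij; rewrite /f eqxx.
case: eqP => [ji|_]; first by rewrite ji ltnn in ij.
rewrite eqxx => /andP[JI sIJ].
by rewrite properEneq eq_sym [X in _ && X]sIJ andbT.
Qed.

(** Cardinality grows by at least one per index. [geI] counts up from index 0, [leI] counts down
    from index [m], where [hm] caps the size; the two bounds meet at [j]. *)
Lemma hom_cell_card j I : I \in eta j -> #|I| = j :> nat.
Proof.
have geI n i K : i = n :> nat -> K \in eta i -> n <= #|K|.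
  elim: n i K => // n IHn i K iE Ki.
  have n_lt : n < m.+1 by rewrite (leq_trans _ (ltn_ord i)) ?iE.
  have [L Ln] := hom_cell_neq0 (Ordinal n_lt).
  have /proper_card : (L : {set P}) \proper K.
    by apply: hom_cell_proper Ln Ki; rewrite /= iE.
  exact: leq_ltn_trans (IHn _ _ _ Ln).
have leI n i K : i + n = m -> K \in eta i -> #|K| + n <= m.
  elim: n i K => [i K _ _|n IHn i K iE Ki]; first by rewrite addn0 hm max_card.
  have i_lt : i.+1 < m.+1.
    by rewrite ltnS; apply: leq_trans (eq_leq iE); rewrite addnS ltnS leq_addr.
  have [L Li] := hom_cell_neq0 (Ordinal i_lt).
  have /proper_card KL : (K : {set P}) \proper L.
    by apply: hom_cell_proper Ki Li => /=.
  apply: leq_trans (IHn _ _ _ Li); last by rewrite /= addSnnS.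
  by rewrite addnS -addSn leq_add2r.
move=> Ij; apply/eqP; rewrite eqn_leq (geI _ j) // andbT.
have jm : j <= m by rewrite -ltnS.
by rewrite -(leq_add2r (m - j)) subnKC // (leI _ j) // subnKC.
Qed.

(** [K] lies in the intersection, which is proper in [I] because [I] and [J] are distinct of equal
    size; so the intersection has at most [i] elements, the size of [K]. *)
Lemma hom_cell_capE i j I J K : j = i.+1 :> nat -> I \in eta j -> J \in eta j ->
  I != J -> K \in eta i -> K = I :&: J :> {set P}.
Proof.
move=> ji Ij Jj IJ Ki; have ij : i < j by rewrite ji.
have sKI := proper_sub (hom_cell_proper _ _ _ _ ij Ki Ij).
have sKJ := proper_sub (hom_cell_proper _ _ _ _ ij Ki Jj).
apply/eqP; rewrite eqEcard subsetI sKI sKJ (hom_cell_card _ _ Ki) -ltnS -ji.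
rewrite -(hom_cell_card _ _ Ij) proper_card // properEneq subsetIl andbT.
apply: contra IJ => /eqP/setIidPl sIJ.
by rewrite -val_eqE eqEcard sIJ /= (hom_cell_card _ _ Ij) (hom_cell_card _ _ Jj).
Qed.

(** Dually, the union is strictly larger than [I] and contained in [K], which has only one element
    more than [I]. *)
Lemma hom_cell_cupE i j I J K : i = j.+1 :> nat -> I \in eta j -> J \in eta j ->
  I != J -> K \in eta i -> K = I :|: J :> {set P}.
Proof.
move=> ij Ij Jj IJ Ki; have ji : j < i by rewrite ij.
have sIK := proper_sub (hom_cell_proper _ _ _ _ ji Ij Ki).
have sJK := proper_sub (hom_cell_proper _ _ _ _ ji Jj Ki).
apply/esym/eqP; rewrite eqEcard subUset sIK sJK (hom_cell_card _ _ Ki) ij.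
rewrite -(hom_cell_card _ _ Ij) proper_card // properEneq subsetUl andbT.
apply: contra IJ => /eqP/esym/setUidPl sJI.
by rewrite eq_sym -val_eqE eqEcard sJI /= (hom_cell_card _ _ Ij)
  (hom_cell_card _ _ Jj).
Qed.

(** Size 0 forces the empty ideal and size [m] the full one. This guarantees that a level with two
    members has neighbouring levels on both sides. *)
Lemma hom_cell_interior j I J :
  I \in eta j -> J \in eta j -> I != J -> 0 < j < m.
Proof.
move=> Ij Jj IJ; have [cI cJ] := (hom_cell_card _ _ Ij, hom_cell_card _ _ Jj).
apply/andP; split; rewrite ltnNge; apply: contra IJ => hj.
  have j0 : j = 0 :> nat by apply/eqP; rewrite -leqn0.
  rewrite -val_eqE /= (cards0_eq (_ : #|I| = 0)) ?cI //.
  by rewrite (cards0_eq (_ : #|J| = 0)) ?cJ.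
have full K : #|K| = j :> nat -> K = [set: P] :> {set P}.
  by move=> cK; apply/eqP; rewrite eqEcard subsetT cardsT cK -hm.
by rewrite -val_eqE /= (full I) // (full J).
Qed.

(* A third element L of eta(j) would satisfy L <= I \/ J and
   L /\ I = L /\ J = I /\ J, whence L = I /\ J by distributivity. *)
Lemma hom_cell_card_le2 j : #|eta j| <= 2.
Proof.
rewrite leqNgt; apply/negP => /card_gt2P[I [J [L [[Ij Jj Lj] [IJ JL LI]]]]].
have /andP[j0 jm] := hom_cell_interior _ _ _ Ij Jj IJ.
have lt_pred : j.-1 < m.+1 by rewrite (leq_ltn_trans (leq_pred j)).
have jE : j = (Ordinal lt_pred).+1 :> nat by rewrite /= prednK.
have lt_succ : j.+1 < m.+1 by [].
have [K Ki] := hom_cell_neq0 (Ordinal lt_pred).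
have [M Mi] := hom_cell_neq0 (Ordinal lt_succ).
have ME := hom_cell_cupE (Ordinal lt_succ) j _ _ _ erefl Ij Jj IJ Mi.
have sLM : L \subset M.
  exact/proper_sub/(hom_cell_proper j (Ordinal lt_succ)).
have KJL := hom_cell_capE _ _ _ _ _ jE Jj Lj JL Ki.
have KLI := hom_cell_capE _ _ _ _ _ jE Lj Ij LI Ki.
have LK : L = K :> {set P}.
  by rewrite -(setIidPl sLM) ME setIUr -KLI setIC -KJL
    setUid.
have : (K : {set P}) \proper L by apply: hom_cell_proper Ki Lj; rewrite /= prednK.
by rewrite LK properxx.
Qed.

Lemma hom_cell_card12 j : #|eta j| = 1 \/ #|eta j| = 2.
Proof.
have := hom_cell_card_le2 j; have : 0 < #|eta j|.
  by have [I Ij] := hom_cell_neq0 j; apply/card_gt0P; exists I.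
by case: #|eta j| => [|[|[|n]]] //; [left | right].
Qed.

(** Serves the neighbours of a two-element level, whose members are all pinned to one intersection
    or one union. *)
Lemma hom_cell_card1 i :
  {in eta i &, forall I J, I = J :> {set P}} -> #|eta i| = 1.
Proof.
move=> eq_eta; case: (hom_cell_card12 i) => // ci.
have /card_gt1P[I [J [Ii Ji]]] : 1 < #|eta i| by rewrite ci.
by rewrite -val_eqE /= (eq_eta I J) ?eqxx.
Qed.

Lemma hom_cell_card2_pred i j : #|eta j| = 2 -> j = i.+1 :> nat -> #|eta i| = 1.
Proof.
move=> cj ji; have /card_gt1P[I [J [Ij Jj IJ]]] : 1 < #|eta j| by rewrite cj.
apply: hom_cell_card1 => K L Ki Li.
by rewrite (hom_cell_capE i j I J K) ?(hom_cell_capE i j I J L).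
Qed.

Lemma hom_cell_card2_succ i j : #|eta j| = 2 -> i = j.+1 :> nat -> #|eta i| = 1.
Proof.
move=> cj ij; have /card_gt1P[I [J [Ij Jj IJ]]] : 1 < #|eta j| by rewrite cj.
apply: hom_cell_card1 => K L Ki Li.
by rewrite (hom_cell_cupE i j I J K) ?(hom_cell_cupE i j I J L).
Qed.

End MaximalChains.

(* C_m is 'I_m.+1 with its canonical order. *)
Theorem theorem4p3 (R : realType) (d : Order.disp_t) (P : finPOrderType d)
    (m : nat) (hm : m = #|P|) :
  (forall eta : {ffun 'I_m.+1 -> {set ideal P}}, hom_cell eta ->
     (forall j : 'I_m.+1, #|eta j| = 1 \/ #|eta j| = 2) /\
     (forall j : 'I_m.+1, #|eta j| = 2 ->
        (forall i : 'I_m.+1, nat_of_ord j = (nat_of_ord i).+1 -> #|eta i| = 1) /\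
        (forall i : 'I_m.+1, nat_of_ord i = (nat_of_ord j).+1 -> #|eta i| = 1))) /\
  cubical_complex (hom_complex 'I_m.+1 (ideal P) R).
Proof.
split=> [eta eta_cell|].
  split=> [|j cj]; first exact: hom_cell_card12.
  split=> i ij; first exact: hom_cell_card2_pred cj ij.
  exact: hom_cell_card2_succ cj ij.
split; first exact: hom_complex_polytopal.
move=> _ [eta eta_cell <-]; apply: cube_cell_polytope => j.
exact: hom_cell_card12.
Qed.
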